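(* Let $1\le p\le d$ and $\lambda\ge 0$. Let $\mathbf{X}^c=[\mathbf{x}^c_1,\dots,\mathbf{x}^c_{n_c}]\in\mathbb{R}^{d\times n_c}$, $c=1,\dots,C$, be data matrices. Let $\mathbf{C}_b(\mathbf{P})$, $\mathbf{C}_w(\mathbf{P})$ and $f(\mathbf{P})$ be the associated between and within cross-covariance matrices and WDA objective function defined in the context. Assume the following. (i) (Monotonicity assumption) There is a constant $\gamma>0$ such that for all $\mathbf{P},\widehat{\mathbf{P}}\in\mathbb{R}^{d\times p}$ with orthonormal columns and all $\eta\in\mathbb{R}$: if $$\frac{\operatorname{tr}(\widehat{\mathbf{P}}^T\mathbf{C}_b(\mathbf{P})\widehat{\mathbf{P}})}{\operatorname{tr}(\widehat{\mathbf{P}}^T\mathbf{C}_w(\mathbf{P})\widehat{\mathbf{P}})}\ge f(\mathbf{P})+\eta,$$ then $f(\widehat{\mathbf{P}})\ge f(\mathbf{P})+\gamma\eta$. (ii) There is a constant $\delta>0$ such that for every $\mathbf{P}\in\mathbb{R}^{d\times p}$ with orthonormal columns, the sum of the $p$ smallest eigenvalues of $\mathbf{C}_w(\mathbf{P})$ is at least $\delta$. (iii) There is a constant $\omega$ such that for every $\mathbf{P}\in\mathbb{R}^{d\times p}$ with orthonormal columns, the sum of the $p$ largest eigenvalues of $\mathbf{C}_w(\mathbf{P})$ is at most $\omega$. Let $\{\mathbf{P}_k\}_{k=0}^\infty$ be a sequence generated by the (exact) WDA-nepv iteration. That is, $\mathbf{P}_0\in\mathbb{R}^{d\times p}$ is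 arbitrary with $\mathbf{P}_0^T\mathbf{P}_0=I_p$, and for each $k\ge 0$, $\mathbf{P}_{k+1}$ is a solution of $$\max_{\mathbf{P}^T\mathbf{P}=I_p}\frac{\operatorname{tr}(\mathbf{P}^T\mathbf{C}_b(\mathbf{P}_k)\mathbf{P})}{\operatorname{tr}(\mathbf{P}^T\mathbf{C}_w(\mathbf{P}_k)\mathbf{P})}$$ which satisfies $$\left[\mathbf{C}_b(\mathbf{P}_k)-\frac{\operatorname{tr}(\mathbf{P}_{k+1}^T\mathbf{C}_b(\mathbf{P}_k)\mathbf{P}_{k+1})}{\operatorname{tr}(\mathbf{P}_{k+1}^T\mathbf{C}_w(\mathbf{P}_k)\mathbf{P}_{k+1})}\,\mathbf{C}_w(\mathbf{P}_k)\right]\mathbf{P}_{k+1}=\mathbf{P}_{k+1}\boldsymbol{\Lambda}_k,$$ where the eigenvalues of $\boldsymbol{\Lambda}_k\in\mathbb{R}^{p\times p}$ are the $p$ largest eigenvalues of the matrix in brackets. Then the following statements hold. (a) The sequence $\{f(\mathbf{P}_k)\}_{k=0}^\infty$ is monotonically increasing (that is, $f(\mathbf{P}_{k+1})\ge f(\mathbf{P}_k)$ for all $k$) and convergent. (b) The sequence $\{\mathbf{P}_k\}_{k=0}^\infty$ has a convergent subsequence $\{\mathbf{P}_k\}_{k\in\mathbb{I}}$, converging to some $\mathbf{P}_*\in\mathbb{R}^{d\times p}$ with $\mathbf{P}_*^T\mathbf{P}_*=I_p$, and $$\lim_{k\to\infty}f(\mathbf{P}_k)=f(\mathbf{P}_*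 ).$$ (c) $\mathbf{P}_*$ is an orthonormal eigenbasis matrix of $$\mathbf{H}_*:=\mathbf{C}_b(\mathbf{P}_* )-f(\mathbf{P}_* )\,\mathbf{C}_w(\mathbf{P}_* )$$ associated with its $p$ largest eigenvalues. (d) If $p<d$ and $\lambda_p(\mathbf{H}_* )-\lambda_{p+1}(\mathbf{H}_* )>0$, where $\lambda_i(\mathbf{H}_* )$ denotes the $i$-th largest eigenvalue of $\mathbf{H}_*$, then $\mathbf{P}_*$ is a maximizer in $$\max_{\mathbf{P}^T\mathbf{P}=I_p}\frac{\operatorname{tr}(\mathbf{P}^T\mathbf{C}_b(\mathbf{P}_* )\mathbf{P})}{\operatorname{tr}(\mathbf{P}^T\mathbf{C}_w(\mathbf{P}_* )\mathbf{P})}.$$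
   Context: Setting (Wasserstein discriminant analysis, WDA). The data consist of $C$ classes. Class $c$ has data points $\mathbf{x}^c_1,\dots,\mathbf{x}^c_{n_c}\in\mathbb{R}^d$, which are the columns of $\mathbf{X}^c$. The number $\lambda\ge0$ is a fixed regularization parameter. A matrix $\mathbf{P}\in\mathbb{R}^{d\times p}$ is called orthonormal if $\mathbf{P}^T\mathbf{P}=I_p$. Optimal transport matrices. For classes $c,c'$ (possibly equal) let $$U_{n_c,n_{c'}}=\Big\{\mathbf{T}\in\mathbb{R}^{n_c\times n_{c'}}:\ T_{ij}\ge0,\ \mathbf{T}\mathbf{1}_{n_{c'}}=\tfrac1{n_c}\mathbf{1}_{n_c},\ \mathbf{T}^T\mathbf{1}_{n_c}=\tfrac1{n_{c'}}\mathbf{1}_{n_{c'}}\Big\},$$ where $\mathbf{1}_m\in\mathbb{R}^m$ is the all-ones vector. Let $h(\mathbf{T})=-\sum_{ij}T_{ij}\log T_{ij}$ (with $0\log 0=0$). For $\mathbf{P}\in\mathbb{R}^{d\times p}$ define $$\mathbf{T}^{c,c'}(\mathbf{P})=\operatorname*{arg\,min}_{\mathbf{T}\in U_{n_c,n_{c'}}}\Big\{\lambda\sum_{ij}T_{ij}\,\|\mathbf{P}^T\mathbf{x}^c_i-\mathbf{P}^T\mathbf{x}^{c'}_j\|_2^2-h(\mathbf{T})\Big\}.$$ This minimizer exists and is unique. Cross-covariance matrices (symmetric $d\times d$ matrices): $$\mathbf{C}_b(\mathbf{P})=\sum_{c}\sum_{c'>c}\sum_{i,j}T^{c,c'}_{ij}(\mathbf{P})(\mathbf{x}^c_i-\mathbf{x}^{c'}_j)(\mathbf{x}^c_i-\mathbf{x}^{c'}_j)^T,$$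 $$\mathbf{C}_w(\mathbf{P})=\sum_{c}\sum_{i,j}T^{c,c}_{ij}(\mathbf{P})(\mathbf{x}^c_i-\mathbf{x}^{c}_j)(\mathbf{x}^c_i-\mathbf{x}^{c}_j)^T.$$ WDA objective function: for orthonormal $\mathbf{P}$, $$f(\mathbf{P})=\frac{\operatorname{tr}(\mathbf{P}^T\mathbf{C}_b(\mathbf{P})\mathbf{P})}{\operatorname{tr}(\mathbf{P}^T\mathbf{C}_w(\mathbf{P})\mathbf{P})}.$$ Conventions. The WDA-nepv iteration is considered in exact form: the optimal transport matrices and the solutions $\mathbf{P}_{k+1}$ of the trace ratio problems are computed exactly, and the iteration is not stopped. An orthonormal eigenbasis matrix of a symmetric matrix $\mathbf{H}\in\mathbb{R}^{d\times d}$ associated with its $p$ largest eigenvalues (counted with multiplicity) is an orthonormal $\mathbf{P}\in\mathbb{R}^{d\times p}$ with $\mathbf{H}\mathbf{P}=\mathbf{P}\boldsymbol{\Lambda}$ for some $\boldsymbol{\Lambda}\in\mathbb{R}^{p\times p}$ whose eigenvalues are the $p$ largest eigenvalues of $\mathbf{H}$. The index set $\mathbb{I}$ is an infinite subset of $\{0,1,2,\dots\}$. *)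

(* Defs.v *)
From mathcomp Require Import all_boot all_order all_algebra.
From mathcomp Require Import all_classical all_reals all_analysis.

Set Implicit Arguments.
Unset Strict Implicit.
Unset Printing Implicit Defensive.

Import Order.TTheory GRing.Theory Num.Theory.
Import numFieldNormedType.Exports.

Local Open Scope classical_set_scope.
Local Open Scope ring_scope.

Section Spectrum.
Variable R : realType.

Definition is_eigvals n (A : 'M[R]_n) (s : seq R) : Prop :=
  sorted >=%R s /\ char_poly A = \prod_(a <- s) ('X - a%:P).

(* The eigenvalues of A with multiplicity, in nonincreasing order. The sequence
   exists exactly when the characteristic polynomial of A splits over R, in
   particular for A symmetric, and it is then unique and of size n; otherwise
   [eigvals A] is the empty sequence. *)
Definition eigvals n (A : 'M[R]_n) : seq R := xget [::] [set s | is_eigvals A s].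

(* [eigval A i] is the i-th largest eigenvalue, counted from i = 1. *)
Definition eigval n (A : 'M[R]_n) (i : nat) : R := nth 0 (eigvals A) i.-1.

Definition sum_largest n (A : 'M[R]_n) (p : nat) : R :=
  \sum_(a <- take p (eigvals A)) a.

Definition sum_smallest n (A : 'M[R]_n) (p : nat) : R :=
  \sum_(a <- drop (n - p) (eigvals A)) a.

Definition orthonormal_mx d p (P : 'M[R]_(d, p)) : Prop := P^T *m P = 1%:M.

Definition top_eigenbasis d p (H : 'M[R]_d) (P : 'M[R]_(d, p)) : Prop :=
  orthonormal_mx P /\
  exists L : 'M[R]_p, H *m P = P *m L /\ eigvals L = take p (eigvals H).

End Spectrum.

Section OptimalTransport.
Variable R : realType.

(* Squared Euclidean norm; the norm that the library puts on matrices is the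
   sup norm. *)
Definition sqnorm2 m (v : 'cV[R]_m) : R := \sum_i v i 0 ^+ 2.

Definition transport_polytope m n : set 'M[R]_(m, n) :=
  [set T : 'M[R]_(m, n) |
    [/\ forall i j, 0 <= T i j,
        T *m const_mx 1 = const_mx m%:R^-1 :> 'cV[R]_m &
        T^T *m const_mx 1 = const_mx n%:R^-1 :> 'cV[R]_n]].

Definition entropy m n (T : 'M[R]_(m, n)) : R :=
  - \sum_i \sum_j T i j * ln (T i j).

Definition ot_objective d p m n (lambda : R) (X : 'M[R]_(d, m))
    (Y : 'M[R]_(d, n)) (P : 'M[R]_(d, p)) (T : 'M[R]_(m, n)) : R :=
  lambda * (\sum_i \sum_j
    T i j * sqnorm2 (P^T *m col i X - P^T *m col j Y)) - entropy T.

(* The minimizer exists and is unique for 0 < m and 0 < n, so the default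
   value 0 is then not used. *)
Definition ot_plan d p m n (lambda : R) (X : 'M[R]_(d, m))
    (Y : 'M[R]_(d, n)) (P : 'M[R]_(d, p)) : 'M[R]_(m, n) :=
  xget 0 [set T : 'M[R]_(m, n) | transport_polytope T /\
    forall T', transport_polytope T' ->
      ot_objective lambda X Y P T <= ot_objective lambda X Y P T'].

End OptimalTransport.

Section WDA.
Variables (R : realType) (d C : nat) (n : 'I_C -> nat).
Variables (X : forall c : 'I_C, 'M[R]_(d, n c)) (lambda : R).
Variable p : nat.
Implicit Types P Q : 'M[R]_(d, p).

Definition cross_cov (c c' : 'I_C) P : 'M[R]_d :=
  \sum_i \sum_j ot_plan lambda (X c) (X c') P i j *:
    ((col i (X c) - col j (X c')) *m (col i (X c) - col j (X c'))^T).

Definition Cb P : 'M[R]_d :=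
  \sum_(c < C) \sum_(c' < C | (c < c')%N) cross_cov c c' P.

Definition Cw P : 'M[R]_d := \sum_(c < C) cross_cov c c P.

(* The covariance matrices are frozen at P while the trace ratio is taken
   at Q. *)
Definition trace_ratio P Q : R :=
  \tr (Q^T *m Cb P *m Q) / \tr (Q^T *m Cw P *m Q).

Definition wda_obj P : R := trace_ratio P P.

Definition trace_ratio_solution P Q : Prop :=
  orthonormal_mx Q /\
  forall Q', orthonormal_mx Q' -> trace_ratio P Q' <= trace_ratio P Q.

Definition wda_nepv_sequence (Ps : nat -> 'M[R]_(d, p)) : Prop :=
  orthonormal_mx (Ps 0%N) /\
  forall k, trace_ratio_solution (Ps k) (Ps k.+1) /\
    top_eigenbasis
      (Cb (Ps k) - trace_ratio (Ps k) (Ps k.+1) *: Cw (Ps k)) (Ps k.+1).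

(* The subsequence (Ps k) for k in I converges to Pstar, which is orthonormal,
   and the objective values converge to the one of Pstar along the whole
   sequence. *)
Definition wda_limit (Ps : nat -> 'M[R]_(d, p)) (I : set nat)
    (Pstar : 'M[R]_(d, p)) : Prop :=
  [/\ infinite_set I,
      Ps k @[k --> within I \oo] --> Pstar,
      orthonormal_mx Pstar &
      wda_obj (Ps k) @[k --> \oo] --> wda_obj Pstar].

End WDA.

(* Main.v *)
Require Import Defs.
From mathcomp Require Import all_boot all_order all_algebra.
From mathcomp Require Import all_classical all_reals all_analysis.
From mathcomp Require Import fingroup perm complex ring lra.

Import Order.TTheory GRing.Theory Num.Theory.
Import numFieldNormedType.Exports.

Local Open Scope classical_set_scope.
Local Open Scope ring_scope.

(** Write [f] for the objective, [r(P, Q)] for the trace ratio at [Q] with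
    covariances frozen at [P], and [rho_k = r(P_k, P_(k+1))], which bounds all
    [r(P_k, Q)]. The monotonicity assumption gives
    [gamma (rho_k - f(P_k)) <= f(P_(k+1)) - f(P_k)], so [f(P_k)] increases.

    Strong convexity of [x ln x] makes the transport plan a continuous function
    of [P], and Ky Fan's inequality bounds the denominators below by [delta];
    hence [r(., Q)] and [f] are continuous on the compact Stiefel manifold. A
    subsequence of [P_k] converges to some [Pstar], and monotonicity of [f(P_k)]
    upgrades [f(P_k) -> f(Pstar)] from the subsequence to the whole sequence.

    Passing to the limit along the subsequence in
    [r(P_k, Q) <= f(P_k) + (f(P_(k+1)) - f(P_k)) / gamma] yields
    [r(Pstar, Q) <= f(Pstar)] for all orthonormal [Q], which is (d). Equivalently
    [Pstar] maximizes [tr(Q^T (C_b - f(Pstar) C_w) Q)], the covariances being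
    taken at [Pstar], and the equality case of Ky Fan's inequality turns this
    into (c). *)

(** * Symmetric matrices and Ky Fan's inequality *)

Section CharPoly.

Lemma char_poly_conj (R : comNzRingType) n (A V W : 'M[R]_n) :
  W *m V = 1%:M -> char_poly (W *m A *m V) = char_poly A.
Proof.
move=> WV; rewrite /char_poly.
have -> : char_poly_mx (W *m A *m V) =
    map_mx polyC W *m char_poly_mx A *m map_mx polyC V.
  rewrite /char_poly_mx mulmxBr mulmxBl !map_mxM/=; congr (_ - _).
  by rewrite mul_mx_scalar -scalemxAl -map_mxM WV map_mx1 scalemx1.
by rewrite !det_mulmx mulrAC -det_mulmx -map_mxM WV map_mx1 det1 mul1r.
Qed.

Lemma char_poly_ublock (R : comNzRingType) m n (A : 'M[R]_m) B (D : 'M[R]_n) :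
  char_poly (block_mx A B 0 D) = char_poly A * char_poly D.
Proof.
rewrite /char_poly /char_poly_mx map_block_mx scalar_mx_block.
by rewrite opp_block_mx add_block_mx map_mx0 subr0 det_ublock.
Qed.

Lemma char_poly_diag (R : comNzRingType) n (D : 'rV[R]_n) :
  char_poly (diag_mx D) = \prod_(i < n) ('X - (D 0 i)%:P).
Proof.
rewrite char_poly_trig ?diag_mx_is_trig//.
by apply: eq_bigr => i _; rewrite mxE eqxx mulr1n.
Qed.

Lemma row_basis_of_rank (F : fieldType) m n q (A : 'M[F]_(m, n)) :
  \rank A = q -> exists B : 'M[F]_(q, n), (B :=: A)%MS.
Proof. by move=> <-; exists (row_base A); exact: eq_row_base. Qed.

(** The missing columns come from a basis of a complement of the row space of [P^T], transposed. *)
Lemma complete_to_unitmx (F : fieldType) p q (P : 'M[F]_(p + q, p)) :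
  row_free P^T -> exists Q : 'M[F]_(p + q, q), row_mx P Q \in unitmx.
Proof.
move=> Pfree.
have [|Q QE] := @row_basis_of_rank _ _ _ q (P^T^C)%MS.
  by rewrite mxrank_compl (eqP Pfree) addKn.
exists Q^T; rewrite -unitmx_tr tr_row_mx trmxK -row_full_unit -sub1mx.
by rewrite -addsmxE (adds_eqmx (eqmx_refl _) QE) sub1mx addsmx_compl_full.
Qed.

(** In a basis that extends the columns of [P], [H] is block upper triangular with [L] as its
    leading block. *)
Lemma char_poly_invariant_subspace (F : fieldType) d p (H : 'M[F]_d)
    (P : 'M[F]_(d, p)) (L : 'M[F]_p) :
  (p <= d)%N -> row_free P^T -> H *m P = P *m L -> char_poly L %| char_poly H.
Proof.
move=> pd; move: H P; rewrite -(subnKC pd) => H P Pfree HP.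
have [Q Su] := complete_to_unitmx _ _ _ _ Pfree.
set S := row_mx P Q in Su.
pose Y := invmx S *m (H *m Q).
rewrite -(char_poly_conj _ _ H S (invmx S)) ?mulVmx//.
have SP : invmx S *m P = col_mx 1%:M 0.
  apply: (can_inj (mulKmx Su)); rewrite mulKVmx//.
  by rewrite mul_row_col mulmx1 mulmx0 addr0.
have -> : invmx S *m H *m S = row_mx (invmx S *m P *m L) Y.
  by rewrite -mulmxA [H *m S]mul_mx_row HP mul_mx_row mulmxA.
rewrite SP mul_col_mx mul1mx mul0mx -[Y]vsubmxK -block_mxEh char_poly_ublock.
exact: dvdp_mulr.
Qed.

End CharPoly.

(** * Prefix sums and subsequences of nonincreasing sequences *)

Section SortedSeq.
Variable R : realDomainType.
Implicit Types (s t : seq R) (a x : R) (p : nat).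

Lemma mem_take_ge s p a : sorted >=%R s -> (p <= size s)%N ->
  a \in take p s -> nth 0 s p.-1 <= a.
Proof.
move=> ss ps /(nthP 0)[k]; rewrite size_take_min (minn_idPl ps) => kp <-.
rewrite nth_take//.
apply: (sorted_leq_nth ge_trans lexx) => //; rewrite ?inE.
- exact: leq_trans kp ps.
- by apply: leq_trans ps; case: (p) kp.
- by case: (p) kp.
Qed.

Lemma mem_drop_le s p a : sorted >=%R s -> a \in drop p s ->
  a <= nth 0 s p.-1.
Proof.
move=> ss /(nthP 0)[k]; rewrite size_drop => kp <-; rewrite nth_drop.
have pk : (p + k < size s)%N by rewrite -ltn_subRL.
have p1 : (p.-1 <= p + k)%N by rewrite (leq_trans (leq_pred p)) ?leq_addr.
apply: (sorted_leq_nth ge_trans lexx) => //; rewrite ?inE.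
exact: leq_ltn_trans pk.
Qed.

(** Entries before position [p] are at least [t] and later ones at most [t], so the positive parts
    of [a - t] single out the prefix. The sum over all of [s] can then be compared with a weighted
    sum term by term. *)
Lemma sum_take_threshold s p (t := nth 0 s p.-1) :
  sorted >=%R s -> (p <= size s)%N ->
  \sum_(a <- take p s) a = p%:R * t + \sum_(a <- s) Num.max 0 (a - t).
Proof.
move=> ss ps; rewrite -{2}(cat_take_drop p s) big_cat/=.
rewrite [X in _ + (_ + X)]big1_seq ?addr0; last first.
  move=> a /andP[_ /(mem_drop_le _ _ _ ss) at_].
  by apply/max_idPl; rewrite subr_le0.
rewrite [X in _ + X](eq_big_seq (fun a => a - t)); last first.
  move=> a /(mem_take_ge _ _ _ ss ps) ta.
  by apply/max_idPr; rewrite subr_ge0.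
rewrite sumrB big_const_seq count_predT size_take_min (minn_idPl ps) iter_addr_0.
by rewrite mulr_natl addrC subrK.
Qed.

(** Skipping an entry of [t] brings a later one forward, and later entries are no larger. *)
Lemma sorted_subseq_nth s t i : sorted >=%R t -> subseq s t ->
  (i < size s)%N -> nth 0 s i <= nth 0 t i.
Proof.
elim: t s i => [|b t IH] [|a s] i //= bt.
have st := path_sorted bt.
case: eqP => [-> sub|ab sub].
  by case: i => [|i] is_ //; exact: (IH s i).
move=> is_; have /= it := leq_trans is_ (size_subseq sub).
apply: le_trans (IH _ _ st sub is_) _.
have /(sortedP 0)/(_ i) : sorted >=%R (b :: t) by [].
exact.
Qed.

Lemma eq_of_le_sum s t : size s = size t ->
  (forall i, (i < size s)%N -> nth 0 s i <= nth 0 t i) ->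
  \sum_(a <- t) a <= \sum_(a <- s) a -> s = t.
Proof.
move=> st le_st; rewrite (big_nth 0) [leRHS](big_nth 0) -st !big_mkord => sum_ts.
apply: (@eq_from_nth _ 0) => // i ilt.
have /psumr_eq0P/(_ (Ordinal ilt) isT)/eqP :
    \sum_(j < size s) (nth 0 t j - nth 0 s j) = 0.
  apply/eqP; rewrite eq_le sumrB subr_le0 sum_ts/= subr_ge0.
  by apply: ler_sum => j _; exact: le_st.
rewrite subr_eq0 => ts; apply/esym/eqP/ts => j _.
by rewrite subr_ge0 le_st.
Qed.

End SortedSeq.

(** * Entries of orthogonal projections *)

Section SymmetricIdempotent.
Variables (R : realDomainType) (n : nat) (E : 'M[R]_n).
Hypotheses (Esym : E^T = E) (Eidem : E *m E = E).

Lemma sym_idem_diagE i : E i i = \sum_k E i k ^+ 2.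
Proof.
rewrite -[in LHS]Eidem mxE; apply: eq_bigr => k _.
by rewrite -{2}Esym mxE.
Qed.

Lemma sym_idem_diag_itv i : 0 <= E i i <= 1.
Proof.
have E0 : 0 <= E i i by rewrite sym_idem_diagE sumr_ge0// => k _; rewrite sqr_ge0.
rewrite E0/=; have : E i i ^+ 2 <= E i i.
  rewrite [leRHS]sym_idem_diagE (bigD1 i)//= lerDl sumr_ge0// => k _.
  by rewrite sqr_ge0.
rewrite expr2; have [->|En0] := eqVneq (E i i) 0; first by rewrite ler01.
by rewrite -{3}[E i i]mul1r ler_pM2r// lt_def En0.
Qed.

(** A value 0 or 1 equals its own square, so the diagonal entry alone exhausts the squared norm of
    its row. *)
Lemma sym_idem_offdiag i j : E i i = 0 \/ E i i = 1 -> i != j -> E i j = 0.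
Proof.
move=> Eii ij; have : \sum_(k | k != i) E i k ^+ 2 = 0.
  have := sym_idem_diagE i; rewrite (bigD1 i)//=.
  case: Eii => ->; rewrite ?expr0n ?expr1n ?add0r// => /esym/(canRL (addKr _)) ->.
  by rewrite addNr.
move=> /psumr_eq0P H; apply/eqP; rewrite -sqrf_eq0; apply/eqP/H.
  by move=> k _; rewrite sqr_ge0.
by rewrite eq_sym.
Qed.

End SymmetricIdempotent.

(** * Orthogonal diagonalization over a real closed field *)

Section RealSpectralTheorem.
Variable R : rcfType.
Local Notation cmx := (map_mx (real_complex R)).

(** Over the complex numbers [H] is Hermitian, hence unitarily diagonalizable with real eigenvalues;
    the embedding reflects roots of the characteristic polynomial. *)
Lemma symmetric_eigenvalue d (H : 'M[R]_d.+1) : H^T = H ->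
  exists a, eigenvalue H a.
Proof.
move=> Hsym; have Hreal : cmx H \is a realmx.
  by apply/mxOverP => i j; rewrite mxE complex_real.
have Hherm : cmx H \is hermsymmx.
  apply: realsym_hermsym Hreal.
  by apply/is_hermitianmxP; rewrite expr0 scale1r map_mx_id// map_trmx Hsym.
have /hermitian_normalmx/orthomx_spectralP HE := Hherm.
have /mxOverP Dreal := hermitian_spectral_diag_real Hherm.
set D := spectral_diag (cmx H) in HE Dreal.
exists (complex.Re (D 0 0)).
rewrite eigenvalue_root_char -(fmorph_root (real_complex R)) map_char_poly.
rewrite {1}HE char_poly_conj; last by rewrite mulVmx// spectral_unit.
rewrite char_poly_diag /= RRe_real//; apply/rootP.
by rewrite horner_prod (bigD1 0)//= hornerXsubC subrr mul0r.
Qed.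

Lemma col_sqr_eq0 m (v : 'cV[R]_m) : v^T *m v = 0 -> v = 0.
Proof.
move=> /matrixP/(_ 0 0); rewrite !mxE => /psumr_eq0P v0.
apply/colP => i; rewrite mxE; apply/eqP; rewrite -sqrf_eq0 expr2.
have := v0 _ i isT; rewrite mxE => ->//.
by move=> k _; rewrite mxE -expr2 sqr_ge0.
Qed.

(* [S] is the Householder reflection that exchanges the first basis vector
   and [v]. *)
Lemma unit_vector_first_column n (v : 'cV[R]_n.+1) : v^T *m v = 1%:M ->
  exists S : 'M[R]_n.+1, S^T *m S = 1%:M /\ S *m delta_mx 0 0 = v.
Proof.
move=> vv; pose e : 'cV[R]_n.+1 := delta_mx 0 0.
have ee : e^T *m e = 1%:M.
  by rewrite trmx_delta mul_delta_mx; apply/matrixP => i j; rewrite !ord1 !mxE.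
have [->|ve] := eqVneq v e.
  by exists 1%:M; rewrite trmx1 !mul1mx.
pose w := v - e; pose c := (w^T *m w) 0 0; pose b := (v^T *m e) 0 0.
have wwE : w^T *m w = c%:M by rewrite -mx11_scalar.
have c0 : c != 0.
  apply: contra_neq ve => c0; apply/eqP; rewrite -subr_eq0; apply/eqP.
  by apply: col_sqr_eq0; rewrite -/w wwE c0 raddf0.
have veE : v^T *m e = b%:M by rewrite -mx11_scalar.
have evE : e^T *m v = b%:M by rewrite -[LHS]trmxK trmx_mul trmxK veE tr_scalar_mx.
have wT : w^T = v^T - e^T by rewrite /w linearB.
have cE : c = 2 - 2 * b.
  rewrite /c wT /w mulmxBl !mulmxBr vv ee veE evE !mxE eqxx !mulr1n.
  ring.
have weE : w^T *m e = (- (c / 2))%:M.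
  rewrite wT mulmxBl veE ee -raddfB/=; congr _%:M; lra.
pose S := 1%:M - (2 / c) *: (w *m w^T).
have ST : S^T = S by rewrite /S linearB/= trmx1 linearZ/= trmx_mul trmxK.
exists S; split.
  rewrite ST /S mulmxBl mul1mx mulmxBr mulmx1 -scalemxAl -scalemxAr.
  rewrite mulmxA -[w *m w^T *m w]mulmxA wwE mul_mx_scalar -scalemxAl !scalerA.
  have -> : 2 / c * (2 / c * c) = 2 / c + 2 / c by field.
  by rewrite scalerDl opprB addrK subrK.
(* As [w^T e = - c / 2], the reflection sends [e] to [e + w = v]. *)
rewrite -/e /S mulmxBl mul1mx -scalemxAl -mulmxA weE mul_mx_scalar scalerA.
rewrite mulrN (_ : _ / _ * _ = 1); last by field.
by rewrite scaleN1r opprK addrC subrK.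
Qed.

(** Induction on the dimension: conjugating by an orthogonal [S] whose first column is a unit
    eigenvector clears the first column below the diagonal. Symmetry clears the first row, and the
    remaining block is symmetric. *)
Lemma real_spectral n (H : 'M[R]_n) : H^T = H ->
  exists (U : 'M[R]_n) (D : 'rV[R]_n),
    U^T *m U = 1%:M /\ H = U^T *m diag_mx D *m U.
Proof.
elim: n H => [|n IH] H Hsym.
  by exists 1%:M, 0; split; apply/matrixP => -[].
have [a /eigenvalueP[v vH v0]] := symmetric_eigenvalue _ _ Hsym.
have vv : 0 < (v *m v^T) 0 0.
  rewrite lt_def; apply/andP; split; last first.
    by rewrite mxE sumr_ge0// => k _; rewrite mxE -expr2 sqr_ge0.
  apply: contra_neq v0 => vv; apply: trmx_inj; rewrite trmx0.
  by apply: col_sqr_eq0; rewrite trmxK [LHS]mx11_scalar vv raddf0.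
have vvE : v *m v^T = ((v *m v^T) 0 0)%:M by rewrite -mx11_scalar.
set x := (v *m v^T) 0 0 in vv vvE.
pose u := (Num.sqrt x)^-1 *: v^T.
have uT : u^T = (Num.sqrt x)^-1 *: v by rewrite /u linearZ/= trmxK.
have uu : u^T *m u = 1%:M.
  rewrite uT /u -scalemxAl -scalemxAr scalerA -invfM -expr2.
  by rewrite sqr_sqrtr ?ltW// vvE scale_scalar_mx mulVf ?gt_eqF.
have Hu : H *m u = a *: u.
  by rewrite /u -scalemxAr -[H in LHS]Hsym -trmx_mul vH linearZ/= !scalerA mulrC.
have [S [SS Se]] := unit_vector_first_column _ _ uu.
have SS' : S *m S^T = 1%:M by exact: mulmx1C.
pose K : 'M[R]_(1 + n) := S^T *m H *m S.
have Ksym : K^T = K by rewrite /K !trmx_mul trmxK Hsym mulmxA.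
have Ke : K *m delta_mx 0 0 = a *: delta_mx 0 0 :> 'cV_n.+1.
  rewrite /K -!mulmxA Se Hu -scalemxAr; congr (_ *: _).
  by rewrite -Se mulmxA SS mul1mx.
have Kcol i : K i 0 = a * (i == 0)%:R.
  have /colP/(_ i) := Ke; rewrite -colE !mxE eqxx andbT => <-.
  by [].
have -> : H = S *m K *m S^T.
  by rewrite /K !mulmxA SS' mul1mx -mulmxA SS' mulmx1.
clearbody K; clear Ke.
have l0 : lshift n (0 : 'I_1) = 0 :> 'I_n.+1 by exact: val_inj.
have KE : K = block_mx a%:M 0 0 (drsubmx K).
  have Kdl : dlsubmx K = 0.
    by apply/matrixP => i j; rewrite ord1 !mxE l0 Kcol mulr0.
  rewrite -[K in LHS]submxK Kdl -[ursubmx K]trmxK trmx_ursub Ksym Kdl trmx0.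
  congr block_mx; apply/matrixP => i j.
  by rewrite !ord1 !mxE l0 Kcol mulr1.
have [|U' [D' [UU' KE']]] := IH (drsubmx K).
  by rewrite trmx_drsub Ksym.
pose B : 'M[R]_(1 + n) := block_mx 1%:M 0 0 U'.
have BB : B^T *m B = 1%:M.
  rewrite /B tr_block_mx !trmx0 trmx1 mulmx_block !mulmx0 !mul0mx !addr0 !add0r.
  by rewrite mulmx1 UU' -scalar_mx_block.
exists (B *m S^T), (row_mx a%:M D'); split.
  by rewrite trmx_mul trmxK mulmxA -[S *m _ *m _]mulmxA BB mulmx1 SS'.
suff -> : K = B^T *m diag_mx (row_mx a%:M D') *m B.
  by rewrite trmx_mul trmxK !mulmxA.
rewrite KE KE' /B diag_mx_row tr_block_mx !trmx0 trmx1 !mulmx_block.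
rewrite !mulmx0 !mul0mx !addr0 !add0r !mul1mx mulmx1; congr block_mx;
  rewrite ?mul0mx//.
by apply/matrixP => i j; rewrite !ord1 !mxE.
Qed.

End RealSpectralTheorem.

(** * Ky Fan's extremal principle with its equality case *)

Section KyFan.
Variable R : realType.

Lemma is_eigvals_uniq n (A : 'M[R]_n) s : is_eigvals A s -> eigvals A = s.
Proof.
move=> [ss As]; rewrite /eigvals.
case: xgetP => [t -> [ts At]|/(_ s)[]//].
apply: (sorted_eq ge_trans ge_anti ts ss); apply: prod_XsubC_eq.
by rewrite -At As.
Qed.

Lemma size_is_eigvals n (A : 'M[R]_n) s : is_eigvals A s -> size s = n.
Proof.
move=> [_ As]; have := size_char_poly A; rewrite As size_prod_XsubC.
by case.
Qed.

(** A diagonalization lists the eigenvalues in some order; permuting the rows of its orthogonal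
    matrix sorts them. *)
Lemma symmetric_eigvals n (H : 'M[R]_n) : H^T = H ->
  is_eigvals H (eigvals H) /\
  exists2 U : 'M[R]_n, U^T *m U = 1%:M &
    H = U^T *m diag_mx (\row_i nth 0 (eigvals H) i) *m U.
Proof.
move=> /real_spectral[U [D [UU HE]]].
have charE : char_poly H = \prod_(i < n) ('X - (D 0 i)%:P).
  by rewrite HE char_poly_conj// char_poly_diag.
pose s := sort >=%R [seq D 0 i | i <- enum 'I_n].
have perm_s : perm_eq s [seq D 0 i | i <- enum 'I_n] by rewrite perm_sort.
have Hs : is_eigvals H s.
  split; first exact: (sort_sorted ge_total).
  by rewrite charE (perm_big _ perm_s) big_map big_enum.
have size_s := size_is_eigvals _ _ _ Hs.
rewrite (is_eigvals_uniq _ _ _ Hs); split => //.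
have : perm_eq (Tuple (introT eqP size_s)) [tuple D 0 i | i < n].
  exact: perm_s.
move=> /tuple_permP[sigma sE].
have sD (i : 'I_n) : nth 0 s i = D 0 (sigma i).
  have -> : s = [tuple tnth [tuple D 0 i | i < n] (sigma i) | i < n] by [].
  by rewrite -tnth_nth !tnth_mktuple.
exists (row_perm sigma U).
  rewrite -UU; apply/matrixP => k l; rewrite !mxE [RHS](reindex_perm sigma)/=.
  by apply: eq_bigr => i _; rewrite !mxE.
rewrite {1}HE -!mulmxA !mul_diag_mx; apply/matrixP => k l.
rewrite !mxE (reindex_perm sigma)/=.
by apply: eq_bigr => i _; rewrite !mxE -sD.
Qed.

Lemma size_eigvals n (H : 'M[R]_n) : H^T = H -> size (eigvals H) = n.
Proof. by move=> /symmetric_eigvals[/size_is_eigvals]. Qed.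

Section Weights.
Variables (d p : nat) (H : 'M[R]_d).
Hypothesis Hsym : H^T = H.
Let lam (i : nat) := nth 0 (eigvals H) i.

Lemma sum_eigvals (f : R -> R) : \sum_(a <- eigvals H) f a = \sum_(i < d) f (lam i).
Proof. by rewrite (big_nth 0) size_eigvals// big_mkord. Qed.

(** The weights are the diagonal of [E], the projection [P P^T] written in an eigenbasis of [H]. In
    the last clause every weight outside the eigenspace of [t] is extreme, so [E] has no entry
    linking distinct eigenspaces. *)
Lemma ky_fan_weights (P : 'M[R]_(d, p)) : P^T *m P = 1%:M ->
  exists w : 'I_d -> R,
    [/\ \tr (P^T *m H *m P) = \sum_(i < d) lam i * w i,
        \sum_i w i = p%:R,
        forall i, 0 <= w i <= 1 &
        forall t, (forall i : 'I_d, lam i != t -> w i = 0 \/ w i = 1) ->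
          H *m (P *m P^T) = P *m P^T *m H].
Proof.
move=> PP; have [_ [U UU HE]] := symmetric_eigvals _ _ Hsym.
have UU' : U *m U^T = 1%:M by exact: mulmx1C.
set D := \row_i _ in HE.
have [Q QP] : exists Q, Q = P *m P^T by eexists.
have [E EQ] : exists E, E = U *m Q *m U^T by eexists.
have QT : Q^T = Q by rewrite QP trmx_mul trmxK.
have QQ : Q *m Q = Q by rewrite QP mulmxA -[P *m P^T *m P]mulmxA PP mulmx1.
have Eidem : E *m E = E.
  by rewrite EQ !mulmxA -[_ *m U^T *m U]mulmxA UU mulmx1 -[U *m _ *m _]mulmxA QQ.
have Esym : E^T = E by rewrite EQ !trmx_mul trmxK QT mulmxA.
have QE : Q = U^T *m E *m U by rewrite EQ !mulmxA UU mul1mx -mulmxA UU mulmx1.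
exists (fun i => E i i); split.
- have -> : \tr (P^T *m H *m P) = \tr (H *m Q).
    by rewrite mxtrace_mulC [RHS]mxtrace_mulC QP mulmxA.
  rewrite {1}HE -mulmxA -mulmxA mxtrace_mulC -mulmxA -EQ mul_diag_mx.
  by apply: eq_bigr => i _; rewrite !mxE.
- rewrite -[LHS]/(\tr E) EQ mxtrace_mulC mulmxA UU mul1mx QP mxtrace_mulC PP.
  exact: mxtrace1.
- by move=> i; exact: sym_idem_diag_itv.
move=> t E01; rewrite -QP {1 2}HE QE !mulmxA -![_ *m U *m U^T]mulmxA UU' !mulmx1.
suff DE : diag_mx D *m E = E *m diag_mx D by rewrite -[_ *m E]mulmxA DE mulmxA.
apply/matrixP => i j; rewrite mul_diag_mx mul_mx_diag !mxE mulrC.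
(* If the two eigenvalues differ, one of them is not [t], and its row of [E] vanishes off the
   diagonal. *)
have [->//|Dij] := eqVneq (nth 0 (eigvals H) i) (nth 0 (eigvals H) j).
have ij : i != j by apply: contra_neq Dij => ->.
suff -> : E i j = 0 by rewrite !mul0r.
have [Dit|Dit] := eqVneq (lam i) t; last exact: sym_idem_offdiag (E01 _ Dit) ij.
rewrite -Esym mxE; apply: sym_idem_offdiag => //; last by rewrite eq_sym.
by apply: E01; rewrite -Dit eq_sym.
Qed.

(** The weights sum to [q], so shifting all eigenvalues by [t] changes both sums by [q t]. The gap
    splits into summands that are nonnegative for weights between 0 and 1. *)
Lemma ky_fan_gap (w : 'I_d -> R) q (t := lam q.-1) :
  (q <= d)%N -> \sum_i w i = q%:R ->
  sum_largest H q - \sum_(i < d) lam i * w i =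
  \sum_(i < d) (Num.max 0 (lam i - t) - (lam i - t) * w i).
Proof.
move=> qd wq; have [[ss _] _] := symmetric_eigvals _ _ Hsym.
rewrite /sum_largest sum_take_threshold ?size_eigvals// -/t.
rewrite (sum_eigvals (fun a => Num.max 0 (a - t))) sumrB -wq mulr_suml.
have -> : \sum_(i < d) (lam i - t) * w i =
    \sum_(i < d) lam i * w i - \sum_i w i * t.
  by rewrite -sumrB; apply: eq_bigr => i _; ring.
ring.
Qed.

Lemma ky_fan_gap_ge0 (a b : R) : 0 <= b <= 1 -> 0 <= Num.max 0 a - a * b.
Proof. by case: (lerP 0 a) => a0 /andP[b0 b1]; nra. Qed.

Lemma sum_weights_le (w : 'I_d -> R) q : (q <= d)%N ->
  (forall i, 0 <= w i <= 1) -> \sum_i w i = q%:R ->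
  \sum_(i < d) lam i * w i <= sum_largest H q.
Proof.
move=> qd w01 wq; rewrite -subr_ge0 ky_fan_gap// sumr_ge0// => i _.
exact: ky_fan_gap_ge0.
Qed.

(** The complementary weights [1 - w i] sum to [d - q]; their upper bound is subtracted from the sum
    of all eigenvalues. *)
Lemma sum_weights_ge (w : 'I_d -> R) q : (q <= d)%N ->
  (forall i, 0 <= w i <= 1) -> \sum_i w i = q%:R ->
  sum_smallest H q <= \sum_(i < d) lam i * w i.
Proof.
move=> qd w01 wq.
have := @sum_weights_le (fun i => 1 - w i) (d - q) (leq_subr _ _).
rewrite sumrB wq sumr_const card_ord natrB// => /(_ _ erefl).
under eq_bigr do rewrite mulrBr mulr1.
rewrite sumrB -(sum_eigvals id) -{1}(cat_take_drop (d - q) (eigvals H)) big_cat/=.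
rewrite -/(sum_largest H (d - q)) -/(sum_smallest H q) => le.
have {}le : sum_largest H (d - q) + sum_smallest H q -
  \sum_(i < d) lam i * w i <= sum_largest H (d - q).
  by apply: le => i; move: (w01 i); lra.
lra.
Qed.

End Weights.

Lemma trace_eigvals n (H : 'M[R]_n) : H^T = H -> \tr H = \sum_(a <- eigvals H) a.
Proof.
move=> Hsym; have [_ [U UU HE]] := symmetric_eigvals _ _ Hsym.
rewrite {1}HE mxtrace_mulC mulmxA (mulmx1C UU) mul1mx mxtrace_diag.
by rewrite (sum_eigvals _ _ Hsym id); apply: eq_bigr => i _; rewrite mxE.
Qed.

Lemma ky_fan_ge d p (H : 'M[R]_d) (P : 'M[R]_(d, p)) :
  H^T = H -> (p <= d)%N -> orthonormal_mx P ->
  sum_smallest H p <= \tr (P^T *m H *m P).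
Proof.
move=> Hsym pd /(ky_fan_weights _ _ _ Hsym)[w [-> wp w01 _]].
exact: sum_weights_ge.
Qed.

(** The first [p] rows of [U] belong to the [p] largest eigenvalues because the spectrum is
    sorted. *)
Lemma ky_fan_attained d p (H : 'M[R]_d) : H^T = H -> (p <= d)%N ->
  exists P : 'M[R]_(d, p), orthonormal_mx P /\
    \tr (P^T *m H *m P) = sum_largest H p.
Proof.
move=> Hsym pd; have [_ [U UU HE]] := symmetric_eigvals _ _ Hsym.
have UU' : U *m U^T = 1%:M by exact: mulmx1C.
pose f := widen_ord pd.
have sub (A : 'M[R]_d) :
    ((rowsub f U)^T)^T *m A *m (rowsub f U)^T = mxsub f f (U *m A *m U^T).
  by rewrite trmxK; apply/matrixP => i j; rewrite !mxE; apply: eq_bigr => k _;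
     rewrite !mxE; congr (_ * _); apply: eq_bigr => l _; rewrite !mxE.
exists (rowsub f U)^T; split.
  rewrite /orthonormal_mx -[X in X *m _]mulmx1 sub mulmx1 UU'.
  by apply/matrixP => i j; rewrite !mxE.
rewrite sub {1}HE !mulmxA UU' mul1mx -mulmxA UU' mulmx1 /sum_largest.
rewrite (big_nth 0) size_takel ?size_eigvals// big_mkord.
by apply: eq_bigr => i _; rewrite !mxE eqxx mulr1n nth_take.
Qed.

(* Equality in Ky Fan's inequality forces the weight of every eigenvector with
   eigenvalue different from [lambda_p] to be 0 or 1, so that [P P^T] commutes
   with [H]; the spectrum of [P^T H P] is then part of the one of [H], and has
   the same sum as the [p] largest eigenvalues. *)
Lemma ky_fan_eq d p (H : 'M[R]_d) (P : 'M[R]_(d, p)) :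
  H^T = H -> (p <= d)%N -> orthonormal_mx P ->
  sum_largest H p <= \tr (P^T *m H *m P) -> top_eigenbasis H P.
Proof.
move=> Hsym pd PP trP; split=> //.
pose L := P^T *m H *m P.
have Lsym : L^T = L by rewrite /L !trmx_mul trmxK Hsym mulmxA.
have HP : H *m P = P *m L.
  have [w [trE wp w01 comm]] := ky_fan_weights _ _ _ Hsym _ PP.
  rewrite -[H *m P]mulmx1 -PP -mulmxA [P *m _]mulmxA mulmxA.
  rewrite (comm (nth 0 (eigvals H) p.-1)) /L ?mulmxA// => i lami.
  set x := nth 0 (eigvals H) i - nth 0 (eigvals H) p.-1.
  have x0 : x != 0 by rewrite subr_eq0.
  have gap0 : Num.max 0 x - x * w i = 0.
    apply: (psumr_eq0P (P := xpredT) (F := fun j : 'I_d =>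
      Num.max 0 (nth 0 (eigvals H) j - nth 0 (eigvals H) p.-1) -
      (nth 0 (eigvals H) j - nth 0 (eigvals H) p.-1) * w j)) => //.
      by move=> j _; exact: ky_fan_gap_ge0.
    apply/eqP; rewrite eq_le -{1}ky_fan_gap// -trE subr_le0 trP/=.
    by apply: sumr_ge0 => j _; exact: ky_fan_gap_ge0.
  (* A zero gap with [x != 0] forces weight 1 when [x > 0] and weight 0 when [x < 0]. *)
  move: gap0; case: (lerP 0 x) => _ /eqP.
    by rewrite subr_eq0 -{1}[x]mulr1 => /eqP/(mulfI x0) <-; right.
  by rewrite sub0r oppr_eq0 mulf_eq0 (negPf x0) => /eqP ->; left.
exists L; split=> //.
have [[sH HE] _] := symmetric_eigvals _ _ Hsym.
have [[sL LE] _] := symmetric_eigvals _ _ Lsym.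
have : subseq (eigvals L) (eigvals H).
  have : char_poly L %| char_poly H.
    by apply: char_poly_invariant_subspace HP => //; apply/row_freeP; exists P.
  rewrite LE HE => /dvdp_prod_XsubC[m].
  rewrite eqp_monic ?monic_prod_XsubC// => /eqP/prod_XsubC_eq perm.
  suff -> : eigvals L = mask m (eigvals H) by exact: mask_subseq.
  apply: (sorted_eq ge_trans ge_anti) => //.
  exact: (sorted_mask ge_trans).
(* As a subsequence, the spectrum of [L] lies entrywise below the first [p] eigenvalues of [H]; the
   trace hypothesis excludes strict inequality. *)
move=> sub; apply: eq_of_le_sum.
- by rewrite size_takel ?size_eigvals.
- rewrite size_eigvals// => i ip; rewrite nth_take//.
  by apply: sorted_subseq_nth; rewrite ?size_eigvals.
by rewrite -trace_eigvals.
Qed.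

End KyFan.

(** * Continuity of the entropic transport plan *)

Section XlnX.
Variable R : realType.
Implicit Types x y m : R.

(* The Bregman divergence of [x ln x] dominates the squared Hellinger
   distance. *)
Lemma xlnx_tangent x m : 0 <= x -> 0 < m ->
  x * ln m + x - m + (Num.sqrt x - Num.sqrt m) ^+ 2 <= x * ln x.
Proof.
move=> x0 m0; have b0 : 0 < Num.sqrt m by rewrite sqrtr_gt0.
rewrite -(sqr_sqrtr x0) -(sqr_sqrtr (ltW m0)) !sqrtr_sqr !ger0_norm ?sqrtr_ge0//.
have := sqrtr_ge0 x; rewrite le_eqVlt => /predU1P[<-|a0].
  by rewrite !expr2; lra.
move: (Num.sqrt x) (Num.sqrt m) a0 b0 => a b a0 b0.
rewrite !lnXn//.
(* With [x = a^2] and [m = b^2] the claim is twice [a^2 (ln b - ln a) <= a b - a^2], that is,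
   [ln z <= z - 1] at [z = b / a]. *)
have /(ler_wpM2l (sqr_ge0 a)) : ln b - ln a <= b / a - 1.
  rewrite -ln_div ?posrE//; have ba : 0 < b / a by rewrite divr_gt0.
  have := @le_ln1Dx R (b / a - 1); rewrite (addrC 1) subrK; apply; lra.
have -> : a ^+ 2 * (b / a - 1) = a * b - a ^+ 2 by field; lra.
nra.
Qed.

(** Factor [x - m] as a difference of squares; the two square roots add up to at most 2, hence the
    constant 4. *)
Lemma sqr_le_sqrt_diff x m : 0 <= x <= 1 -> 0 <= m <= 1 ->
  (x - m) ^+ 2 <= 4 * (Num.sqrt x - Num.sqrt m) ^+ 2.
Proof.
move=> /andP[x0 x1] /andP[m0 m1].
have sqrt1 (z : R) : z <= 1 -> Num.sqrt z <= 1.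
  by move=> z1; rewrite -sqrtr1 ler_wsqrtr.
rewrite -{1}(sqr_sqrtr x0) -{1}(sqr_sqrtr m0) subr_sqr exprMn mulrC.
rewrite ler_wpM2r ?sqr_ge0//.
have := sqrt1 _ x1; have := sqrt1 _ m1; have := sqrtr_ge0 x; have := sqrtr_ge0 m.
by nra.
Qed.

(** When the tangent bounds at [m] for [x] and [y] are added, the terms [x - m] and [y - m] cancel.
    Each Hellinger term is at least [(x - y)^2 / 16], both points being at distance [|x - y| / 2]
    from [m]. *)
Lemma xlnx_midpoint x y (m := (x + y) / 2) : 0 <= x <= 1 -> 0 <= y <= 1 ->
  (x - y) ^+ 2 / 8 <= x * ln x + y * ln y - 2 * (m * ln m).
Proof.
move=> x01 y01; have mE : m = (x + y) / 2 by [].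
clearbody m; have [[x0 x1] [y0 y1]] := (andP x01, andP y01).
have m01 : 0 <= m <= 1 by rewrite mE; apply/andP; split; lra.
(* The tangent bound needs [m > 0]; otherwise [x] and [y] are both 0. *)
have [m0|m0] := ltP 0 m; last first.
  have xE : x = 0 by rewrite mE in m0; lra.
  have yE : y = 0 by rewrite mE in m0; lra.
  by rewrite mE xE yE expr2 !(add0r, mul0r, mulr0, oppr0, addr0).
have xm := sqr_le_sqrt_diff _ _ x01 m01; have ym := sqr_le_sqrt_diff _ _ y01 m01.
have xt := xlnx_tangent _ _ x0 m0; have yt := xlnx_tangent _ _ y0 m0.
have x_m : x - m = (x - y) / 2 by rewrite mE; lra.
have y_m : y - m = - ((x - y) / 2) by rewrite mE; lra.
have -> : 2 * (m * ln m) = x * ln m + y * ln m by rewrite {1}mE; field.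
 rewrite x_m in xm; rewrite y_m in ym.
have xyE : ((x - y) / 2) ^+ 2 = (x - y) ^+ 2 / 4 by field.
rewrite sqrrN xyE in ym; rewrite xyE in xm; lra.
Qed.

(** Multiply [- ln a <= 1 / a - 1] at [a = sqrt x] by [2 a^2]. For [x <= 0] the default value
    [ln x = 0] makes both sides 0. *)
Lemma norm_xlnx_le x : x <= 1 -> `|x * ln x| <= 2 * Num.sqrt x.
Proof.
have [x0 _|x0 x1] := leP x 0; first by rewrite ln0// mulr0 normr0 ler0_sqrtr// mulr0.
rewrite normrM gtr0_norm// ler0_norm ?ln_le0//.
have a0 : 0 < Num.sqrt x by rewrite sqrtr_gt0.
rewrite -{1 2}(sqr_sqrtr (ltW x0)) lnXn//.
move: (Num.sqrt x) a0 => a a0.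
have /(ler_wpM2l (ltW a0)) : - ln a <= a^-1 - 1.
  rewrite -lnV//; have ba : 0 < a^-1 by rewrite invr_gt0.
  have := @le_ln1Dx R (a^-1 - 1); rewrite (addrC 1) subrK; apply; lra.
rewrite mulrBr divff ?gt_eqF// => ale.
rewrite expr2 mulr2n; nra.
Qed.

Lemma continuous_xlnx : continuous (fun x => x * ln x).
Proof.
move=> x; have [x0|x0] := ltP 0 x.
  by apply: cvgM; [exact: cvg_id|exact: continuous_ln].
rewrite /continuous_at ln0// mulr0; apply: norm_cvg0.
(* Since [x <= 0], the square root of [y] tends to 0, and [y <= 1] holds near [x]. *)
apply: (@squeeze_cvgr _ _ _ _ (fun=> 0) (fun y => 2 * Num.sqrt y)).
- near=> y; rewrite normr_ge0/= norm_xlnx_le//; near: y.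
  by have /cvgr_le := @cvg_id _ (nbhs x); apply; lra.
- exact: cvg_cst.
- have := cvgM (cvg_cst (2 : R)) (@sqrt_continuous R x).
  rewrite ler0_sqrtr// mulr0; exact.
Unshelve. all: end_near. Qed.

End XlnX.

(** * Continuity and compactness for matrices, entry by entry *)

Section MatrixTopology.
Variable R : realType.

Lemma continuous_sumr (T : topologicalType) I (r : seq I) (P : pred I)
    (f : I -> T -> R) : (forall i, P i -> continuous (f i)) ->
  continuous (fun x => \sum_(i <- r | P i) f i x).
Proof. by apply: continuous_big; exact: add_continuous. Qed.

Lemma continuous_mulr (T : topologicalType) (f g : T -> R) :
  continuous f -> continuous g -> continuous (fun x => f x * g x).
Proof. by move=> cf cg x; exact: cvgM (cf x) (cg x). Qed.

Lemma continuous_addr (T : topologicalType) (f g : T -> R) :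
  continuous f -> continuous g -> continuous (fun x => f x + g x).
Proof. by move=> cf cg x; exact: cvgD (cf x) (cg x). Qed.

Lemma continuous_subr (T : topologicalType) (f g : T -> R) :
  continuous f -> continuous g -> continuous (fun x => f x - g x).
Proof. by move=> cf cg x; exact: cvgB (cf x) (cg x). Qed.

Lemma continuous_compose (T U V : topologicalType) (f : T -> U) (g : U -> V) :
  continuous f -> continuous g -> continuous (fun x => g (f x)).
Proof. by move=> cf cg x; exact: continuous_comp (cf x) (cg (f x)). Qed.

Lemma continuous_at_sqr_bound (T : topologicalType) (f h : T -> R) (x : T) :
  continuous h -> h x = 0 -> (forall y, (f y - f x) ^+ 2 <= h y) ->
  f y @[y --> x] --> f x.
Proof.
move=> hc h0 fh; apply/subr_cvg0; apply: norm_cvg0.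
apply: (@squeeze_cvgr _ _ _ _ (fun=> 0) (fun y => Num.sqrt (h y))).
- by near=> y; rewrite normr_ge0/= -sqrtr_sqr ler_wsqrtr.
- exact: cvg_cst.
- have := continuous_compose _ _ _ _ _ hc (@sqrt_continuous R) x.
  by rewrite /continuous_at/= h0 sqrtr0.
Unshelve. all: end_near. Qed.

Lemma cvg_mx T (F : set_system T) {FF : Filter F} m n
    (f : T -> 'M[R]_(m, n)) (l : 'M[R]_(m, n)) :
  (forall i j, f x i j @[x --> F] --> l i j) -> f @ F --> l.
Proof.
move=> fl; apply/cvg_ballP => e e0.
have /filter_forall : forall i, \forall x \near F, forall j, ball (l i j) e (f x i j).
  move=> i; apply: (filter_forall
    (f := fun j => [set x | ball (l i j) e (f x i j)])) => j.
  by have /cvg_ballP := fl i j; apply.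
by apply: filterS => x xe; split.
Qed.

Lemma continuous_mx (T : topologicalType) m n (f : T -> 'M[R]_(m, n)) :
  (forall i j, continuous (fun x => f x i j)) -> continuous f.
Proof. by move=> fc x; exact: (@cvg_mx _ (nbhs x)) (fun i j => fc i j x). Qed.

Lemma compact_mx_cube m n (M : R) :
  compact [set A : 'M[R]_(m, n) | forall i j, `|A i j| <= M].
Proof.
pose B := [set v : 'rV[R]_(m * n) | forall k, v ord0 k \in `[- M, M]].
have -> : [set A : 'M[R]_(m, n) | forall i j, `|A i j| <= M] = vec_mx @` B.
  apply/seteqP; split => [A AM|_ [v vB <-] i j]/=.
    exists (mxvec A); last exact: mxvecK.
    by move=> k; case/mxvec_indexP: k => i j; rewrite mxvecE in_itv/= -ler_norml.
  by rewrite mxE ler_norml; have := vB (mxvec_index i j); rewrite in_itv.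
apply: continuous_compact.
  apply: continuous_subspaceT; apply: continuous_mx => i j.
  rewrite [X in continuous X](_ : _ =
    fun v : 'rV[R]_(m * n) => v 0 (mxvec_index i j)).
    exact: coord_continuous.
  by apply/funext => v; rewrite mxE.
apply: (@rV_compact _ _ (fun=> `[- M, M]%classic)).
by move=> _; exact: segment_compact.
Qed.

Lemma continuous_mulmx_col m n p (A : 'M[R]_(n, p)) i j :
  continuous (fun B : 'M[R]_(m, n) => (B *m A) i j).
Proof.
rewrite [X in continuous X](_ : _ =
  fun B : 'M[R]_(m, n) => \sum_k B i k * A k j); last first.
  by apply/funext => B; rewrite mxE.
apply: continuous_sumr => k _; apply: continuous_mulr; last exact: cst_continuous.
exact: coord_continuous.
Qed.

Lemma continuous_trmx m n : continuous (@trmx R m n).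
Proof.
apply: continuous_mx => i j.
rewrite [X in continuous X](_ : _ = fun A : 'M[R]_(m, n) => A j i).
  exact: coord_continuous.
by apply/funext => A; rewrite mxE.
Qed.

Lemma closed_mx_eq (T : topologicalType) m n (f g : T -> 'M[R]_(m, n)) :
  (forall i j, continuous (fun x => f x i j - g x i j)) ->
  closed [set x | f x = g x].
Proof.
move=> fg; have -> : [set x | f x = g x] =
    \bigcap_(ij in [set: 'I_m * 'I_n])
      ((fun x => f x ij.1 ij.2 - g x ij.1 ij.2) @^-1` [set 0]).
  apply/seteqP; split => [x/= fgx ij _/=|x H]; first by rewrite fgx subrr.
  by apply/matrixP => i j; have /= /eqP := H (i, j) I; rewrite subr_eq0 => /eqP.
apply: closed_bigI => ij _; apply: preimage_closed; last exact: closed_eq.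
by move=> x _; exact: fg.
Qed.

End MatrixTopology.

(** * Existence and stability of the optimal plan *)

Section OptimalPlan.
Variable R : realType.

Lemma transport_polytope_row m n (T : 'M[R]_(m, n)) i :
  transport_polytope T -> \sum_j T i j = m%:R^-1.
Proof.
move=> [_ /colP/(_ i) rowT _]; move: rowT; rewrite !mxE => <-.
by apply: eq_bigr => j _; rewrite mxE mulr1.
Qed.

Lemma transport_polytope_itv m n (T : 'M[R]_(m, n)) i j :
  transport_polytope T -> 0 <= T i j <= 1.
Proof.
move=> HT; have [T0 _ _] := HT; rewrite T0/=.
apply: (@le_trans _ _ (m%:R^-1)).
  rewrite -(transport_polytope_row _ _ _ i HT) (bigD1 j)//= lerDl.
  by apply: sumr_ge0 => k _; exact: T0.
rewrite invf_le1 ?ltr0n ?ler1n; exact: leq_ltn_trans (ltn_ord i).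
Qed.

Lemma transport_polytope_midpoint m n (T T' : 'M[R]_(m, n)) :
  transport_polytope T -> transport_polytope T' ->
  transport_polytope (2^-1 *: (T + T')).
Proof.
move=> [T0 Tr Tc] [T'0 T'r T'c]; split.
- by move=> i j; rewrite !mxE mulr_ge0 ?invr_ge0// addr_ge0.
- rewrite -scalemxAl mulmxDl Tr T'r; apply/colP => i; rewrite !mxE; lra.
- rewrite linearZ/= linearD/= -scalemxAl mulmxDl Tc T'c.
  by apply/colP => i; rewrite !mxE; lra.
Qed.

(** The witness is the product of the two uniform marginals. *)
Lemma transport_polytope_neq0 m n : (0 < m)%N -> (0 < n)%N ->
  @transport_polytope R m n !=set0.
Proof.
move=> m0 n0; exists (const_mx (m%:R^-1 * n%:R^-1)); split.
- by move=> i j; rewrite mxE mulr_ge0// invr_ge0.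
- apply/colP => i; rewrite !mxE.
  under eq_bigr do rewrite !mxE mulr1.
  by rewrite sumr_const card_ord -[_ *+ n]mulr_natr mulfVK// pnatr_eq0 -lt0n.
- apply/colP => i; rewrite !mxE.
  under eq_bigr do rewrite !mxE mulr1.
  by rewrite sumr_const card_ord -[_ *+ m]mulr_natl mulVKf// pnatr_eq0 -lt0n.
Qed.

Lemma transport_polytope_compact m n : compact (@transport_polytope R m n).
Proof.
apply: (subclosed_compact _ (@compact_mx_cube R m n 1)); last first.
  move=> T HT i j; have /andP[T0 T1] := transport_polytope_itv _ _ _ i j HT.
  by rewrite ger0_norm.
have -> : @transport_polytope R m n =
    (\bigcap_(ij in [set: 'I_m * 'I_n])
      ((fun T : 'M[R]_(m, n) => T ij.1 ij.2) @^-1` [set x | 0 <= x])) `&`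
    ([set T | T *m const_mx 1 = const_mx m%:R^-1 :> 'cV[R]_m] `&`
     [set T | T^T *m const_mx 1 = const_mx n%:R^-1 :> 'cV[R]_n]).
  apply/seteqP; split => T; first by move=> [T0 ? ?]; split => // -[i j] _ /=.
  by move=> [T0 [? ?]]; split => // i j; have := T0 (i, j) I.
apply: closedI.
  apply: closed_bigI => ij _; apply: preimage_closed; last exact: closed_ge.
  by move=> x _; exact: coord_continuous.
apply: closedI; apply: closed_mx_eq => i j; apply: continuous_subr.
- exact: continuous_mulmx_col.
- exact: cst_continuous.
- apply: (continuous_compose _ _ _ (@trmx R m n) (fun B => (B *m const_mx 1) i j)).
    exact: continuous_trmx.
  exact: continuous_mulmx_col.
- exact: cst_continuous.
Qed.

Lemma ot_objectiveE d p m n (lambda : R) (X : 'M[R]_(d, m)) (Y : 'M[R]_(d, n))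
    (P : 'M[R]_(d, p)) T :
  ot_objective lambda X Y P T = \sum_i \sum_j
    (T i j * (lambda * sqnorm2 (P^T *m col i X - P^T *m col j Y)) +
     T i j * ln (T i j)).
Proof.
rewrite /ot_objective /entropy opprK mulr_sumr -big_split/=; apply: eq_bigr => i _.
by rewrite mulr_sumr -big_split/=; apply: eq_bigr => j _; rewrite mulrCA.
Qed.

(** The continuous objective attains its minimum on the compact nonempty polytope, so [xget] does
    not fall back to its default. *)
Lemma ot_plan_spec d p m n (lambda : R) (X : 'M[R]_(d, m)) (Y : 'M[R]_(d, n))
    (P : 'M[R]_(d, p)) : (0 < m)%N -> (0 < n)%N ->
  transport_polytope (ot_plan lambda X Y P) /\
  forall T, transport_polytope T ->
    ot_objective lambda X Y P (ot_plan lambda X Y P) <= ot_objective lambda X Y P T.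
Proof.
move=> m0 n0; rewrite /ot_plan; case: xgetP => [T _ []//|none]; exfalso.
have cont : continuous (ot_objective lambda X Y P).
  rewrite (funext (ot_objectiveE _ _ _ _ lambda X Y P)).
  apply: continuous_sumr => i _; apply: continuous_sumr => j _.
  apply: continuous_addr.
    by apply: continuous_mulr; [exact: coord_continuous|exact: cst_continuous].
  apply: (continuous_compose _ _ _
    (fun T : 'M[R]_(m, n) => T i j) (fun x => x * ln x)).
    exact: coord_continuous.
  exact: continuous_xlnx.
have [T Tin Tmin] := compact_EVT_min (transport_polytope_neq0 _ _ m0 n0)
  (transport_polytope_compact m n) (continuous_subspaceT cont).
apply: (none T); split; first exact: set_mem.
by move=> T' T'in; apply: Tmin; exact: mem_set.
Qed.

(* Both objectives are compared with their value at the midpoint of the two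
   plans; the entropy gains a quadratic term there. *)
Lemma ot_plan_stability d p m n (lambda : R) (X : 'M[R]_(d, m)) (Y : 'M[R]_(d, n))
    (P Q : 'M[R]_(d, p)) (i : 'I_m) (j : 'I_n) :
  (ot_plan lambda X Y P i j - ot_plan lambda X Y Q i j) ^+ 2 <=
  4 * \sum_i \sum_j `|lambda * sqnorm2 (Q^T *m col i X - Q^T *m col j Y) -
                      lambda * sqnorm2 (P^T *m col i X - P^T *m col j Y)|.
Proof.
(* The indices [i] and [j] witness that neither point set is empty. *)
have m0 : (0 < m)%N by exact: leq_ltn_trans (ltn_ord i).
have n0 : (0 < n)%N by exact: leq_ltn_trans (ltn_ord j).
have [] := ot_plan_spec _ _ _ _ lambda X Y P m0 n0.
have [] := ot_plan_spec _ _ _ _ lambda X Y Q m0 n0.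
move: (ot_plan _ _ _ P) (ot_plan _ _ _ Q) => S T HT Tmin HS Smin.
have HM := transport_polytope_midpoint _ _ _ _ HS HT.
move: (Smin _ HM) (Tmin _ HM); rewrite !ot_objectiveE !pair_bigA/=.
set c1 := fun k : 'I_m * 'I_n =>
  lambda * sqnorm2 (P^T *m col k.1 X - P^T *m col k.2 Y).
set c2 := fun k : 'I_m * 'I_n =>
  lambda * sqnorm2 (Q^T *m col k.1 X - Q^T *m col k.2 Y).
move=> FS FT.
have S01 (k : 'I_m * 'I_n) := transport_polytope_itv _ _ _ k.1 k.2 HS.
have T01 (k : 'I_m * 'I_n) := transport_polytope_itv _ _ _ k.1 k.2 HT.
(* Adding the two comparisons leaves [(c2 - c1) (S - T) / 2] on the cost side, against an entropy
   term of at least [(S - T)^2 / 8]; hence the factor 4. *)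
have : \sum_k (S k.1 k.2 - T k.1 k.2) ^+ 2 <=
       \sum_k (4 * ((c2 k - c1 k) * (S k.1 k.2 - T k.1 k.2))).
  rewrite -subr_ge0 -sumrB.
  have := lerD FS FT; rewrite -subr_ge0 -!big_split/= -sumrB => FST.
  suff : 0 <= \sum_k (4 * ((c2 k - c1 k) * (S k.1 k.2 - T k.1 k.2)) -
      (S k.1 k.2 - T k.1 k.2) ^+ 2) / 8.
    by rewrite -mulr_suml pmulr_lge0// invr_gt0.
  apply: le_trans FST _; apply: ler_sum => k _; rewrite !mxE.
  have := xlnx_midpoint _ _ _ (S01 k) (T01 k).
  rewrite [(S k.1 k.2 + T k.1 k.2) / 2]mulrC -/(c1 k) -/(c2 k).
  move: (ln (S k.1 k.2)) (ln (T k.1 k.2)) (ln (_ * (_ + _))) (c1 k) (c2 k).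
  by move: (S k.1 k.2) (T k.1 k.2) => x y a b c e f; nra.
have Tk0 : 0 <= \sum_(k | k != (i, j)) (S k.1 k.2 - T k.1 k.2) ^+ 2.
  by apply: sumr_ge0 => k _; exact: sqr_ge0.
rewrite [leLHS](bigD1 (i, j))//= => le.
apply: le_trans (_ : _ <= \sum_k (4 * ((c2 k - c1 k) * (S k.1 k.2 - T k.1 k.2)))) _.
  by apply: le_trans le; rewrite lerDl.
rewrite -mulr_sumr ler_pM2l//; apply: ler_sum => k _.
apply: (le_trans (ler_norm _)); rewrite normrM ler_piMr//.
move: (S01 k) (T01 k) => /andP[? ?] /andP[? ?].
by rewrite ler_norml; apply/andP; split; lra.
Qed.

Lemma continuous_sqnorm2 d p (v : 'cV[R]_d) :
  continuous (fun P : 'M[R]_(d, p) => sqnorm2 (P^T *m v)).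
Proof.
apply: continuous_sumr => k _.
have cont : continuous (fun P : 'M[R]_(d, p) => (P^T *m v) k 0).
  apply: (continuous_compose _ _ _ (@trmx R d p) (fun B => (B *m v) k 0)).
    exact: continuous_trmx.
  exact: continuous_mulmx_col.
exact: continuous_mulr.
Qed.

Lemma continuous_ot_plan d p m n (lambda : R) (X : 'M[R]_(d, m)) (Y : 'M[R]_(d, n))
    (i : 'I_m) (j : 'I_n) :
  continuous (fun P : 'M[R]_(d, p) => ot_plan lambda X Y P i j).
Proof.
move=> P0.
(* The stability bound with one plan fixed at [P0]: continuous in [P] and zero at [P0]. *)
pose h (P : 'M[R]_(d, p)) : R := 4 * \sum_i \sum_j
  `|lambda * sqnorm2 (P0^T *m col i X - P0^T *m col j Y) -
    lambda * sqnorm2 (P^T *m col i X - P^T *m col j Y)|.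
have hcont : continuous h.
  apply: continuous_mulr; first exact: cst_continuous.
  apply: continuous_sumr => k _; apply: continuous_sumr => l _.
  apply: (continuous_compose _ _ _ _ (fun x : R => `|x|));
    last exact: norm_continuous.
  apply: continuous_subr; first exact: cst_continuous.
  apply: continuous_mulr; first exact: cst_continuous.
  by under eq_fun do rewrite -mulmxBr; exact: continuous_sqnorm2.
have h0 : h P0 = 0.
  rewrite /h big1 ?mulr0// => k _; rewrite big1// => l _.
  by rewrite subrr normr0.
have stab P : (ot_plan lambda X Y P i j - ot_plan lambda X Y P0 i j) ^+ 2 <= h P.
  exact: ot_plan_stability.
exact: continuous_at_sqr_bound hcont h0 stab.
Qed.

End OptimalPlan.

(** * The iteration *)

Section Subsequences.

Lemma infinite_natP (I : set nat) :
  infinite_set I <-> forall N, exists2 k, I k & (N <= k)%N.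
Proof.
split=> [Iinf N|unb /finite_seqP[s Is]].
  apply: contrapT => noI; apply: Iinf.
  apply: sub_finite_set (finite_II N) => k Ik /=.
  by rewrite ltnNge; apply/negP => Nk; apply: noI; exists k.
have [k Ik] := unb (\max_(i <- s) i).+1; rewrite ltnNge => /negP; apply.
by apply: (@leq_bigmax_seq _ s xpredT id) => //; move: Ik; rewrite Is.
Qed.

(** Properness makes limits along [I] unique and lets inequalities pass to them. *)
Lemma within_infinite_proper (I : set nat) :
  infinite_set I -> ProperFilter (within I \oo).
Proof.
move=> /infinite_natP Iinf; apply: Build_ProperFilter_ex => P [N _ NP].
by have [k Ik Nk] := Iinf N; exists k; exact: NP.
Qed.

(** Around a cluster point [x], pick indices [phi N >= N] with [u (phi N)] within [1 / (N + 1)] of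
    [x]; their range is [I]. *)
Lemma compact_subsequence (R : realType) (T : pseudoMetricType R) (A : set T)
    (u : nat -> T) : compact A -> (forall k, A (u k)) ->
  exists (I : set nat) (x : T),
    [/\ infinite_set I, A x & u k @[k --> within I \oo] --> x].
Proof.
move=> Acompact uA.
have [|x [Ax xcl]] := Acompact (u @ \oo) _.
  by exists 0%N => // k _; exact: uA.
have /choice[phi phiP] : forall N, exists k, (N <= k)%N /\ ball x N.+1%:R^-1 (u k).
  move=> N.
  have [||y [[k Nk <-] ballk]] :=
    xcl (u @` [set k | (N <= k)%N]) (ball x N.+1%:R^-1).
  - by exists N => // k /= Nk; exists k.
  - by apply: nbhsx_ballx; rewrite invr_gt0.
  - by exists k.
exists (range phi), x; split => //.
  apply/infinite_natP => N; exists (phi N); first by exists N.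
  by have [] := phiP N.
apply/cvg_ballP => e e0.
have [M Me] : exists M : nat, M.+1%:R^-1 < e.
  by exists (Num.truncn e^-1); rewrite invf_plt ?posrE// truncnS_gt.
(* [phi] may fail to be monotone; an index [phi n] beyond all [phi i] with [i < M] still has
   [n >= M]. *)
exists (\max_(i < M) phi i).+1 => // k /= Mk [n _ phin].
rewrite -phin; apply: le_ball (phiP n).2; apply: le_trans (ltW Me).
rewrite lef_pV2 ?posrE// ler_nat ltnS leqNgt; apply/negP => nM.
have := @leq_bigmax 'I_M (fun i => phi i) (Ordinal nM).
by rewrite /= phin leqNgt Mk.
Qed.

End Subsequences.

Section Stiefel.
Variables (R : realType) (d p : nat).
Implicit Type P : 'M[R]_(d, p).

Lemma orthonormal_mx_itv P i j : orthonormal_mx P -> `|P i j| <= 1.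
Proof.
move=> /matrixP/(_ j j); rewrite !mxE eqxx mulr1n => PP.
rewrite -(@expr_le1 _ 2)// -normrX ger0_norm ?sqr_ge0// -PP.
rewrite (bigD1 i)//= mxE -expr2 lerDl.
by apply: sumr_ge0 => k _; rewrite mxE -expr2 sqr_ge0.
Qed.

Lemma orthonormal_mx_compact : compact [set P : 'M[R]_(d, p) | orthonormal_mx P].
Proof.
apply: (subclosed_compact _ (@compact_mx_cube R d p 1)); last first.
  by move=> P PP i j; exact: orthonormal_mx_itv.
apply: closed_mx_eq => i j; apply: continuous_subr; last exact: cst_continuous.
rewrite [X in continuous X](_ : _ = fun P : 'M[R]_(d, p) => \sum_k P k i * P k j).
  by apply: continuous_sumr => k _; apply: continuous_mulr; exact: coord_continuous.
by apply/funext => P; rewrite mxE; apply: eq_bigr => k _; rewrite mxE.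
Qed.

End Stiefel.

(** * Symmetry of the covariances and continuity of the trace ratio *)

Section CrossCovariance.
Variables (R : realType) (d C : nat) (n : 'I_C -> nat).
Variables (X : forall c : 'I_C, 'M[R]_(d, n c)) (lambda : R).
Variable p : nat.
Implicit Types P Q : 'M[R]_(d, p).

Lemma cross_cov_sym c c' P :
  (cross_cov X lambda c c' P)^T = cross_cov X lambda c c' P.
Proof.
rewrite /cross_cov linear_sum/=; apply: eq_bigr => i _.
rewrite linear_sum/=; apply: eq_bigr => j _.
by rewrite linearZ/= trmx_mul trmxK.
Qed.

Lemma Cb_sym P : (Cb X lambda P)^T = Cb X lambda P.
Proof.
rewrite /Cb linear_sum/=; apply: eq_bigr => c _; rewrite linear_sum/=.
by apply: eq_bigr => c' _; exact: cross_cov_sym.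
Qed.

Lemma Cw_sym P : (Cw X lambda P)^T = Cw X lambda P.
Proof. by rewrite /Cw linear_sum/=; apply: eq_bigr => c _; exact: cross_cov_sym. Qed.

Lemma trace_rank1 Q (v : 'cV[R]_d) :
  \tr (Q^T *m (v *m v^T) *m Q) = sqnorm2 (Q^T *m v).
Proof.
have -> : Q^T *m (v *m v^T) *m Q = (Q^T *m v) *m (Q^T *m v)^T.
  by rewrite trmx_mul trmxK !mulmxA.
rewrite /mxtrace /sqnorm2; apply: eq_bigr => k _.
by rewrite [LHS]mxE big_ord1 [_^T _ _]mxE expr2.
Qed.

Lemma trace_conj_sum I (r : seq I) (S : pred I) (A : I -> 'M[R]_d) Q :
  \tr (Q^T *m (\sum_(i <- r | S i) A i) *m Q) =
  \sum_(i <- r | S i) \tr (Q^T *m A i *m Q).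
Proof. by rewrite mulmx_sumr mulmx_suml linear_sum. Qed.

(** Each summand of the covariance has rank one, so its trace is a squared norm. Continuity then
    reduces to that of the plan entries and of [sqnorm2]. *)
Lemma trace_cross_cov c c' P Q :
  \tr (Q^T *m cross_cov X lambda c c' P *m Q) =
  \sum_i \sum_j ot_plan lambda (X c) (X c') P i j *
    sqnorm2 (Q^T *m (col i (X c) - col j (X c'))).
Proof.
rewrite trace_conj_sum; apply: eq_bigr => i _; rewrite trace_conj_sum.
by apply: eq_bigr => j _; rewrite -scalemxAr -scalemxAl linearZ/= trace_rank1.
Qed.

Variable g : 'M[R]_(d, p) -> 'M[R]_(d, p).
Hypothesis g_continuous : continuous g.

(** The identity as [g] serves the objective; a constant [g] serves the ratio at a fixed comparison
    matrix. *)
Lemma continuous_trace_cross_cov c c' :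
  continuous (fun P => \tr ((g P)^T *m cross_cov X lambda c c' P *m g P)).
Proof.
under eq_fun do rewrite trace_cross_cov.
apply: continuous_sumr => i _; apply: continuous_sumr => j _.
apply: continuous_mulr; first exact: continuous_ot_plan.
exact: continuous_compose g_continuous (@continuous_sqnorm2 R d p _).
Qed.

Lemma continuous_trace_Cb :
  continuous (fun P => \tr ((g P)^T *m Cb X lambda P *m g P)).
Proof.
under eq_fun do [rewrite trace_conj_sum; under eq_bigr do rewrite trace_conj_sum].
apply: continuous_sumr => c _; apply: continuous_sumr => c' _.
exact: continuous_trace_cross_cov.
Qed.

Lemma continuous_trace_Cw :
  continuous (fun P => \tr ((g P)^T *m Cw X lambda P *m g P)).
Proof.
under eq_fun do rewrite trace_conj_sum.
by apply: continuous_sumr => c _; exact: continuous_trace_cross_cov.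
Qed.

Lemma trace_ratio_cvg P : \tr ((g P)^T *m Cw X lambda P *m g P) != 0 ->
  trace_ratio X lambda P' (g P') @[P' --> P] --> trace_ratio X lambda P (g P).
Proof.
move=> den.
exact: cvgM (continuous_trace_Cb P) (cvgV den (continuous_trace_Cw P)).
Qed.

End CrossCovariance.

Theorem theorem4 (R : realType) (d p C : nat) (n : 'I_C -> nat)
    (X : forall c : 'I_C, 'M[R]_(d, n c)) (lambda gamma delta omega : R)
    (Ps : nat -> 'M[R]_(d, p)) :
  (1 <= p <= d)%N ->
  (forall c, (0 < n c)%N) ->
  0 <= lambda ->
  0 < gamma ->
  (forall (P Q : 'M[R]_(d, p)) (eta : R),
    orthonormal_mx P -> orthonormal_mx Q ->
    wda_obj X lambda P + eta <= trace_ratio X lambda P Q ->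
    wda_obj X lambda P + gamma * eta <= wda_obj X lambda Q) ->
  0 < delta ->
  (forall P : 'M[R]_(d, p), orthonormal_mx P ->
    delta <= sum_smallest (Cw X lambda P) p) ->
  (forall P : 'M[R]_(d, p), orthonormal_mx P ->
    sum_largest (Cw X lambda P) p <= omega) ->
  wda_nepv_sequence X lambda Ps ->
  [/\ (forall k, wda_obj X lambda (Ps k) <= wda_obj X lambda (Ps k.+1)) /\
      cvgn (fun k => wda_obj X lambda (Ps k)),
      exists (I : set nat) (Pstar : 'M[R]_(d, p)),
        wda_limit X lambda Ps I Pstar,
      forall (I : set nat) (Pstar : 'M[R]_(d, p)),
        wda_limit X lambda Ps I Pstar ->
        top_eigenbasis
          (Cb X lambda Pstar - wda_obj X lambda Pstar *: Cw X lambda Pstar)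
          Pstar &
      forall (I : set nat) (Pstar : 'M[R]_(d, p)),
        wda_limit X lambda Ps I Pstar ->
        let H := Cb X lambda Pstar - wda_obj X lambda Pstar *: Cw X lambda Pstar
        in (p < d)%N -> 0 < eigval H p - eigval H p.+1 ->
        trace_ratio_solution X lambda Pstar Pstar].
Proof.
move=> /andP[_ pd] _ _ gamma0 mono delta0 Cw_ge _ [Ps0 PsS].
have Ps_orth k : orthonormal_mx (Ps k).
  by case: k => [//|k]; have [[]] := PsS k.
have den_gt0 (P Q : 'M[R]_(d, p)) : orthonormal_mx P -> orthonormal_mx Q ->
    0 < \tr (Q^T *m Cw X lambda P *m Q).
  move=> Po Qo; apply: lt_le_trans delta0 _; apply: le_trans (Cw_ge _ Po) _.
  exact: ky_fan_ge (Cw_sym _ _ _ _ X lambda _ P) pd Qo.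
pose f k := wda_obj X lambda (Ps k).
have ratio_le k (Q : 'M[R]_(d, p)) : orthonormal_mx Q ->
    trace_ratio X lambda (Ps k) Q <= f k + (f k.+1 - f k) / gamma.
  move=> Qo; have [[_ /(_ Q Qo) Qle] _] := PsS k; apply: le_trans Qle _.
  rewrite -lerBlDl ler_pdivlMr// lerBrDl mulrC.
  (* Here [eta] is the optimal ratio minus [f k], so the premise holds with equality. *)
  by apply: mono => //; rewrite addrC subrK.
have f_mono k : f k <= f k.+1.
  have := ratio_le k _ (Ps_orth k); rewrite -[leLHS]addr0 lerD2l.
  by rewrite pmulr_lge0 ?invr_gt0// subr_ge0.
have f_nd : nondecreasing_seq f by apply/nondecreasing_seqP.
have [I [Pstar [Iinf Pstar_orth PsI]]] :=
  compact_subsequence _ _ _ Ps (orthonormal_mx_compact R d p) Ps_orth.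
have obj_cvg (P : 'M[R]_(d, p)) : orthonormal_mx P ->
    wda_obj X lambda P' @[P' --> P] --> wda_obj X lambda P.
  move=> Po; apply: (trace_ratio_cvg _ _ _ _ X lambda _ id).
    by move=> ?; exact: cvg_id.
  by rewrite gt_eqF// den_gt0.
have f_cvg : f @ \oo --> wda_obj X lambda Pstar.
  have fI : f k @[k --> within I \oo] --> wda_obj X lambda Pstar.
    exact: cvg_comp PsI (obj_cvg _ Pstar_orth).
  have Iproper := within_infinite_proper I Iinf.
  have f_le k : f k <= wda_obj X lambda Pstar.
    apply: cvgr_to_ge fI _; exists k => // l /= kl _; exact: f_nd.
  have f_is_cvg : cvgn f.
    apply: nondecreasing_is_cvgn => //.
    by exists (wda_obj X lambda Pstar) => _ [k _ <-].
  (* The limit of the bounded monotone sequence is also its limit along [I], hence the objective at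
     [Pstar]. *)
  have -> : wda_obj X lambda Pstar = lim (f @ \oo); last by [].
  apply: cvg_unique fI _; first exact: Rhausdorff.
  exact: cvg_within_filter f_is_cvg.
(* Any subsequential limit is treated here, since (c) and (d) range over all of them. *)
have maximizer J Q0 : wda_limit X lambda Ps J Q0 ->
    trace_ratio_solution X lambda Q0 Q0.
  move=> [Jinf PsJ Q0o fQ0]; split=> // Q Qo.
  have Jproper := within_infinite_proper J Jinf.
  have lhs : trace_ratio X lambda (Ps k) Q @[k --> within J \oo] -->
      trace_ratio X lambda Q0 Q.
    have den : \tr (Q^T *m Cw X lambda Q0 *m Q) != 0 by rewrite gt_eqF// den_gt0.
    exact: cvg_comp PsJ
      (trace_ratio_cvg _ _ _ _ X lambda _ (fun=> Q) (@cst_continuous _ _ Q) _ den).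
  have rhs : f k + (f k.+1 - f k) / gamma @[k --> within J \oo] -->
      wda_obj X lambda Q0.
    (* The shifted limit is taken along all indices before restricting to [J], because [k.+1] may
       lie outside [J]. *)
    have fS : f k.+1 @[k --> \oo] --> wda_obj X lambda Q0 by rewrite cvg_shiftS.
    have full : f k + (f k.+1 - f k) / gamma @[k --> \oo] -->
        wda_obj X lambda Q0 + (wda_obj X lambda Q0 - wda_obj X lambda Q0) / gamma.
      exact: cvgD fQ0 (cvgM (cvgB fS fQ0) (cvg_cst gamma^-1)).
    rewrite subrr mul0r addr0 in full; exact: cvg_within_filter full.
  by apply: ler_cvg_to lhs rhs _; near=> k; exact: ratio_le.
split.
- by split=> //; apply/cvg_ex; exists (wda_obj X lambda Pstar).
- by exists I, Pstar.
- move=> J Q0 lim_Q0; have [Q0o Q0max] := maximizer _ _ lim_Q0.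
  set H := _ - _.
  have Hsym : H^T = H by rewrite /H linearB/= linearZ/= Cb_sym Cw_sym.
  have trH Q : \tr (Q^T *m H *m Q) = \tr (Q^T *m Cb X lambda Q0 *m Q) -
      wda_obj X lambda Q0 * \tr (Q^T *m Cw X lambda Q0 *m Q).
    by rewrite /H mulmxBr mulmxBl linearB/= -scalemxAr -scalemxAl linearZ.
  apply: ky_fan_eq => //.
  have [Q [Qo <-]] := ky_fan_attained _ d p H Hsym pd.
  (* The trace at [Q0] is 0 by definition of the objective; at the Ky Fan maximizer [Q] it is at
     most 0 because the ratio at [Q] does not exceed the objective. *)
  rewrite !trH {2}/wda_obj /trace_ratio divfK ?gt_eqF ?den_gt0// subrr subr_le0.
  by rewrite -ler_pdivrMr ?den_gt0//; exact: Q0max.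
by move=> J Q0 lim_Q0 H _ _; exact: maximizer lim_Q0.
Unshelve. all: end_near. Qed.
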